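(* Let $r\ge2$ and let $\mathcal A_q$, $\mathcal A_q^{\rm cir}$, $\mathcal I$, $\mathcal I_q$, $\phi$ and $\overline\phi:\mathcal A_q/\mathcal I\to\mathcal A_q/\mathcal I_q$ be as defined in the context. The restriction of the $\mathbb Z[q,q^{-1}]$-module isomorphism $\overline\phi$ to $\mathcal A_q^{\rm cir}/\mathcal I$ is a $\mathbb Z[q,q^{-1}]$-algebra isomorphism of $\mathcal A_q^{\rm cir}/\mathcal I$ onto $\mathcal A_q^{\rm cir}/\mathcal I_q$.
   Context: Fix an integer $r\ge 2$ and the alphabet $\mathbb A=\{1,2,\dots,r\}$. A biword is a $2\times n$ matrix $\alpha=\binom{x_1\cdots x_n}{a_1\cdots a_n}$ ($n\ge 0$) with entries in $\mathbb A$, of length $\ell(\alpha)=n$, viewed as the word $\binom{x_1}{a_1}\cdots\binom{x_n}{a_n}$ in biletters; the product of biwords is concatenation, the empty biword is the unit $1$, and $\mathcal B$ is the set of all biwords. A circuit is a biword whose top word $x_1\cdots x_n$ is a rearrangement of the letters of its bottom word $a_1\cdots a_n$. $\mathcal A_q=\mathbb Z[q,q^{-1}]\langle\langle\mathcal B\rangle\rangle$ is the algebra of all (possibly infinite) formal sums $E=\sum_{\alpha\in\mathcal B}c(\alpha)\alpha$, $c(\alpha)\in\mathbb Z[q,q^{-1}]$, with product induced by concatenation. $E^{(n)}=\sum_{\ell(\alpha)=n}c(\alpha)\alpha$ (a finite sum) is the degree-$n$ homogeneous component. $E$ is circular if $c(\alpha)=0$ whenever $\alpha$ is not a circuit; $\mathcal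 A_q^{\rm cir}$ is the subalgebra of circular elements of $\mathcal A_q$. Relations. For $x>y$ in $\mathbb A$ put $$\left[{xy\atop ab}\right]=\binom{yx}{ba}+\binom{yx}{ab}-\binom{xy}{ba}\ (a>b),\quad \left[{xy\atop aa}\right]=\binom{yx}{aa}\ (\text{all } a),$$ $$\left[{xy\atop ab}\right]_q=\binom{yx}{ba}+q\binom{yx}{ab}-q^{-1}\binom{xy}{ba}\ (a>b),\quad \left[{xy\atop aa}\right]_q=q\binom{yx}{aa}\ (\text{all } a).$$ Ideals. $\mathcal I$ (resp. $\mathcal I_q$) denotes the two-sided ideal of $\mathcal A_q$ generated by the elements $\binom{xy}{ab}-\left[{xy\atop ab}\right]$ (resp. $\binom{xy}{ab}-\left[{xy\atop ab}\right]_q$), $x>y$, $a\ge b$. This is understood degreewise: $E$ belongs to the ideal if and only if, for every $n\ge0$, $E^{(n)}$ belongs to the two-sided ideal generated by the same elements in the algebra $\mathbb Z[q,q^{-1}]\langle\mathcal B\rangle$ of finite sums. $\mathcal A_q^{\rm cir}/\mathcal I$ and $\mathcal A_q^{\rm cir}/\mathcal I_q$ denote the images of $\mathcal A_q^{\rm cir}$ in $\mathcal A_q/\mathcal I$ and $\mathcal A_q/\mathcal I_q$ (equivalently, the quotients of $\mathcal A_q^{\rm cir}$ by its intersection with the ideal). Weight. For a word $w=w_1\cdots w_n$, $\operatorname{inv}w=\#\{(i,j):1\le i<j\le n,\ w_i>w_j\}$. For a biword $\alpha=\binom uv$, $\operatorname{inv}^-(\alpha)=\operatorname{inv}v-\operatorname{inv}u$.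 The map $\phi:\mathcal A_q\to\mathcal A_q$ is $\phi\bigl(\sum_\alpha c(\alpha)\alpha\bigr)=\sum_\alpha c(\alpha)q^{\operatorname{inv}^-(\alpha)}\alpha$, a $\mathbb Z[q,q^{-1}]$-module isomorphism, and $\overline\phi:\mathcal A_q/\mathcal I\to\mathcal A_q/\mathcal I_q$, $E+\mathcal I\mapsto\phi(E)+\mathcal I_q$, is the $\mathbb Z[q,q^{-1}]$-module isomorphism it induces. *)

(* Defs.v *)
From HB Require Import structures.
From mathcomp Require Import all_boot all_order all_algebra.
From mathcomp Require Import boolp.

Set Implicit Arguments.
Unset Strict Implicit.
Unset Printing Implicit Defensive.

Import GRing.Theory.
Local Open Scope ring_scope.
Local Open Scope quotient_scope.

Local Notation "x %:F" := (FracField.tofrac x).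

(* Z[q,q^-1] is realized as the subring of Z(q) = Frac Z[X] of the p / X^n.   *)

Definition laurent_pred : {pred {fraction {poly int}}} :=
  fun x => `[< exists n (p : {poly int}), x = p%:F / ('X : {poly int})%:F ^+ n >].

Lemma fracX_neq0 n : ('X : {poly int})%:F ^+ n != 0.
Proof. by rewrite expf_neq0 // tofrac_eq0 polyX_eq0. Qed.

Lemma laurent_subring : subring_closed laurent_pred.
Proof.
split=> [|x y /asboolP[m [a ->]] /asboolP[n [b ->]]|
         x y /asboolP[m [a ->]] /asboolP[n [b ->]]]; apply/asboolP.
- by exists 0, 1; rewrite expr0 divr1 tofrac1.
- exists (m + n)%N, (a * 'X ^+ n - b * 'X ^+ m).
  rewrite tofracB !tofracM !tofracXn exprD.
  rewrite -mulNr addf_div ?fracX_neq0 //.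
  by rewrite mulNr.
- exists (m + n)%N, (a * b).
  by rewrite tofracM exprD mulf_div.
Qed.

HB.instance Definition _ :=
  GRing.isSubringClosed.Build _ laurent_pred laurent_subring.

Record laurent := Laurent {
  laurent_val : {fraction {poly int}};
  _ : laurent_val \in laurent_pred
}.
HB.instance Definition _ := [isSub for laurent_val].
HB.instance Definition _ := [Choice of laurent by <:].
HB.instance Definition _ := [SubChoice_isSubComNzRing of laurent by <:].

Definition laurent_unit : {pred laurent} :=
  fun x => (val x != 0) && ((val x)^-1 \in laurent_pred).
Definition laurent_inv (x : laurent) : laurent :=
  if laurent_unit x then insubd x (val x)^-1 else x.

Lemma laurent_mulVx : {in laurent_unit, left_inverse 1 laurent_inv *%R}.
Proof.
move=> x ux; have /andP[x0 xV] := ux.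
apply: val_inj; rewrite /laurent_inv [laurent_unit x]ux.
by rewrite GRing.valM GRing.val1 insubdK // mulVf.
Qed.

Lemma laurent_unitPl x y : y * x = 1 -> laurent_unit x.
Proof.
move=> /(congr1 val); rewrite GRing.valM GRing.val1 => yx1.
have x0 : val x != 0.
  by apply: contra_eq_neq yx1 => ->; rewrite mulr0 eq_sym oner_neq0.
rewrite /laurent_unit x0 /=.
have -> : (val x)^-1 = val y by rewrite -[RHS](mulfK x0) yx1 mul1r.
exact: valP.
Qed.

Lemma laurent_inv_out : {in [predC laurent_unit], laurent_inv =1 id}.
Proof. by move=> x /negPf nux; rewrite /laurent_inv [laurent_unit x]nux. Qed.

HB.instance Definition _ := GRing.ComNzRing_hasMulInverse.Build laurent
  laurent_mulVx laurent_unitPl laurent_inv_out.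

Lemma laurentX_subproof : ('X : {poly int})%:F \in laurent_pred.
Proof. by apply/asboolP; exists 0, 'X; rewrite expr0 divr1. Qed.

Definition q : laurent := Laurent laurentX_subproof.

Lemma q_unit : q \is a GRing.unit.
Proof.
rewrite unfold_in /= /laurent_unit /= tofrac_eq0 polyX_eq0 /=.
by apply/asboolP; exists 1, 1; rewrite expr1 tofrac1 div1r.
Qed.

(* The alphabet {1 < ... < r} is 'I_r with its natural order; the biletter    *)
(* with top letter x and bottom letter a is the pair (x, a).                  *)

Definition biword (r : nat) := seq ('I_r * 'I_r).

Definition top r (alpha : biword r) : seq 'I_r := unzip1 alpha.
Definition bottom r (alpha : biword r) : seq 'I_r := unzip2 alpha.

Definition circuit r (alpha : biword r) : bool :=
  perm_eq (top alpha) (bottom alpha).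

Definition inv r (w : seq 'I_r) : nat :=
  #|[set p : 'I_(size w) * 'I_(size w) |
      (p.1 < p.2)%N && (tnth (in_tuple w) p.2 < tnth (in_tuple w) p.1)%N]|.

Definition invm r (alpha : biword r) : int :=
  (inv (bottom alpha))%:Z - (inv (top alpha))%:Z.

(* Wrapped in a record so that the product below cannot be confused with      *)
(* the pointwise one.                                                         *)
Record biseries (r : nat) := Biseries { coef : biword r -> laurent }.
HB.instance Definition _ r := [isNew for @coef r].
HB.instance Definition _ r := [Choice of biseries r by <:].

Section Algebra.
Variable r : nat.
Implicit Types (E F G : biseries r) (alpha beta : biword r).

Lemma biseriesP E F : (forall alpha, coef E alpha = coef F alpha) -> E = F.
Proof. by move=> EF; apply: val_inj; apply/funext. Qed.

Definition zeros : biseries r := Biseries (fun=> 0).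
Definition opps E := Biseries (fun alpha => - coef E alpha).
Definition adds E F := Biseries (fun alpha => coef E alpha + coef F alpha).
Definition scales (c : laurent) E := Biseries (fun alpha => c * coef E alpha).

Definition mono alpha : biseries r := Biseries (fun beta => (beta == alpha)%:R).

(* The pairs (take i alpha, drop i alpha), 0 <= i <= l(alpha), are the        *)
(* factorizations of alpha as a product of two biwords.                       *)
Definition conv (E F : biword r -> laurent) alpha : laurent :=
  \sum_(i < (size alpha).+1) E (take i alpha) * F (drop i alpha).
Definition muls E F := Biseries (conv (coef E) (coef F)).

Fact addsA : associative adds.
Proof. by move=> E F G; apply: biseriesP => a /=; rewrite addrA. Qed.
Fact addsC : commutative adds.
Proof. by move=> E F; apply: biseriesP => a /=; rewrite addrC. Qed.
Fact add0s : left_id zeros adds.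
Proof. by move=> E; apply: biseriesP => a /=; rewrite add0r. Qed.
Fact addNs : left_inverse zeros opps adds.
Proof. by move=> E; apply: biseriesP => a /=; rewrite addNr. Qed.

HB.instance Definition _ := GRing.isZmodule.Build (biseries r)
  addsA addsC add0s addNs.

Lemma conv_nil (E F : biword r -> laurent) : conv E F [::] = E [::] * F [::].
Proof. by rewrite /conv big_ord1. Qed.

Lemma conv_cons (E F : biword r -> laurent) x alpha :
  conv E F (x :: alpha) =
  E [::] * F (x :: alpha) + conv (fun beta => E (x :: beta)) F alpha.
Proof. by rewrite /conv /= big_ord_recl /=. Qed.

Lemma eq_convl (E E' F : biword r -> laurent) alpha :
  E =1 E' -> conv E F alpha = conv E' F alpha.
Proof. by move=> EE'; apply: eq_bigr => i _; rewrite EE'. Qed.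

Lemma convDl (E E' F : biword r -> laurent) alpha :
  conv (fun beta => E beta + E' beta) F alpha = conv E F alpha + conv E' F alpha.
Proof. by rewrite /conv -big_split; apply: eq_bigr => i _; rewrite mulrDl. Qed.

Lemma convZl c (E F : biword r -> laurent) alpha :
  conv (fun beta => c * E beta) F alpha = c * conv E F alpha.
Proof. by rewrite /conv mulr_sumr; apply: eq_bigr => i _; rewrite mulrA. Qed.

Lemma convDr (E F F' : biword r -> laurent) alpha :
  conv E (fun beta => F beta + F' beta) alpha = conv E F alpha + conv E F' alpha.
Proof. by rewrite /conv -big_split; apply: eq_bigr => i _; rewrite mulrDr. Qed.

Lemma convZr c (E F : biword r -> laurent) alpha :
  conv E (fun beta => c * F beta) alpha = c * conv E F alpha.
Proof. by rewrite /conv mulr_sumr; apply: eq_bigr => i _; rewrite mulrCA. Qed.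

Lemma convA (E F G : biword r -> laurent) alpha :
  conv E (conv F G) alpha = conv (conv E F) G alpha.
Proof.
elim: alpha E F G => [|x alpha IH] E F G; first by rewrite !conv_nil mulrA.
rewrite !conv_cons conv_nil IH.
rewrite (@eq_convl (fun beta => conv E F (x :: beta))
  (fun beta => E [::] * F (x :: beta) + conv (fun b => E (x :: b)) F beta));
  last by move=> b; rewrite conv_cons.
by rewrite convDl convZl mulrDr mulrA addrA.
Qed.

Lemma conv0l (E F : biword r -> laurent) alpha :
  E =1 (fun=> 0) -> conv E F alpha = 0.
Proof. by move=> E0; rewrite /conv big1 // => i _; rewrite E0 mul0r. Qed.

Lemma conv1l (F : biword r -> laurent) alpha :
  conv (coef (mono [::])) F alpha = F alpha.
Proof.
case: alpha => [|x alpha]; first by rewrite conv_nil /= mul1r.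
by rewrite conv_cons conv0l ?addr0 /= ?mul1r.
Qed.

Lemma conv1r (E : biword r -> laurent) alpha :
  conv E (coef (mono [::])) alpha = E alpha.
Proof.
elim: alpha E => [|x alpha IH] E; first by rewrite conv_nil /= mulr1.
by rewrite conv_cons IH /= mulr0 add0r.
Qed.

Fact mulsA : associative muls.
Proof. by move=> E F G; apply: biseriesP => a; apply: convA. Qed.
Fact mul1s : left_id (mono [::]) muls.
Proof. by move=> F; apply: biseriesP => a; apply: conv1l. Qed.
Fact muls1 : right_id (mono [::]) muls.
Proof. by move=> F; apply: biseriesP => a; apply: conv1r. Qed.
Fact mulsDl : left_distributive muls adds.
Proof. by move=> E F G; apply: biseriesP => a; apply: convDl. Qed.
Fact mulsDr : right_distributive muls adds.
Proof. by move=> E F G; apply: biseriesP => a; apply: convDr. Qed.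
Fact ones_neq0 : mono [::] != zeros.
Proof.
by apply/eqP => /(congr1 (fun E => coef E [::]))/eqP /=; rewrite oner_eq0.
Qed.

HB.instance Definition _ := GRing.Zmodule_isNzRing.Build (biseries r)
  mulsA mul1s muls1 mulsDl mulsDr ones_neq0.

Fact scalesA a b E : scales a (scales b E) = scales (a * b) E.
Proof. by apply: biseriesP => al /=; rewrite mulrA. Qed.
Fact scale1s : left_id 1 scales.
Proof. by move=> E; apply: biseriesP => al /=; rewrite mul1r. Qed.
Fact scalesDr : right_distributive scales +%R.
Proof. by move=> a E F; apply: biseriesP => al /=; rewrite mulrDr. Qed.
Fact scalesDl E : {morph scales^~ E : a b / a + b}.
Proof. by move=> a b; apply: biseriesP => al /=; rewrite mulrDl. Qed.

HB.instance Definition _ := GRing.Zmodule_isLmodule.Build laurent (biseries r)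
  scalesA scale1s scalesDr scalesDl.

Fact scalesAl (c : laurent) E F : c *: (E * F) = (c *: E) * F.
Proof. by apply: biseriesP => al /=; rewrite convZl. Qed.
Fact scalesAr (c : laurent) E F : c *: (E * F) = E * (c *: F).
Proof. by apply: biseriesP => al /=; rewrite convZr. Qed.

HB.instance Definition _ :=
  GRing.Lmodule_isLalgebra.Build laurent (biseries r) scalesAl.
HB.instance Definition _ :=
  GRing.Lalgebra_isAlgebra.Build laurent (biseries r) scalesAr.

Lemma coefD E F al : coef (E + F) al = coef E al + coef F al. Proof. by []. Qed.
Lemma coefN E al : coef (- E) al = - coef E al. Proof. by []. Qed.
Lemma coefZ c E al : coef (c *: E) al = c * coef E al. Proof. by []. Qed.
Lemma coefM E F al : coef (E * F) al = conv (coef E) (coef F) al.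
Proof. by []. Qed.
Lemma coef_sum I (s : seq I) (P : pred I) (E : I -> biseries r) al :
  coef (\sum_(i <- s | P i) E i) al = \sum_(i <- s | P i) coef (E i) al.
Proof. by elim/big_rec2: _ => // i y1 y2 _ <-. Qed.

Lemma monoM alpha beta : mono alpha * mono beta = mono (alpha ++ beta).
Proof.
apply: biseriesP => gamma; rewrite coefM.
elim: alpha gamma => [|x alpha IH] gamma; first exact: conv1l.
case: gamma => [|y gamma]; first by rewrite conv_nil /= mul0r.
rewrite conv_cons /= mul0r add0r eqseq_cons.
rewrite (@eq_convl _ (fun b => (y == x)%:R * coef (mono alpha) b)); last first.
  by move=> b /=; rewrite eqseq_cons; case: eqP; rewrite ?mul1r ?mul0r.
by rewrite convZl IH /=; case: eqP; rewrite ?mul1r ?mul0r.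
Qed.

Definition circular : {pred biseries r} :=
  fun E => `[< forall alpha, ~~ circuit alpha -> coef E alpha = 0 >].

Lemma circuit_cat alpha beta :
  circuit alpha -> circuit beta -> circuit (alpha ++ beta).
Proof. by rewrite /circuit /top /bottom /unzip1 /unzip2 !map_cat => *; apply: perm_cat. Qed.

Lemma circular_closed : GRing.subsemialg_closed circular.
Proof.
split.
- by apply/asboolP => -[].
- split; first by apply/asboolP.
  by move=> E F /asboolP cE /asboolP cF; apply/asboolP => al nal;
    rewrite coefD cE ?cF ?addr0.
- by move=> c E /asboolP cE; apply/asboolP => al nal; rewrite coefZ cE ?mulr0.
- move=> E F /asboolP cE /asboolP cF; apply/asboolP => al nal.
  rewrite coefM /conv big1 // => i _.
  have [c1|/cE->] := boolP (circuit (take i al)); last by rewrite mul0r.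
  have [c2|/cF->] := boolP (circuit (drop i al)); last by rewrite mulr0.
  by move: nal; rewrite -{1}(cat_take_drop i al) circuit_cat.
Qed.

HB.instance Definition _ :=
  GRing.isSubalgClosed.Build _ _ circular circular_closed.

Definition homog (n : nat) E : biseries r :=
  Biseries (fun alpha => if size alpha == n then coef E alpha else 0).

Definition finite_sum E : Prop :=
  exists s : seq (biword r), forall alpha, alpha \notin s -> coef E alpha = 0.

(* The cofactors range over Z[q,q^-1]<B>, not over all of A_q. *)
Definition finite_ideal (gens : biseries r -> Prop) E : Prop :=
  exists (m : nat) (f g h : 'I_m -> biseries r),
    (forall i, [/\ finite_sum (f i), gens (g i) & finite_sum (h i)])
    /\ E = \sum_(i < m) f i * g i * h i.

(* Membership is tested degree by degree: an element of infinite support may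
   need infinitely many products f * g * h. *)
Definition degreewise_ideal (gens : biseries r -> Prop) : {pred biseries r} :=
  fun E => `[< forall n, finite_ideal gens (homog n E) >].

(* bi2 x y a b is the biword with top word xy and bottom word ab. *)
Definition bi2 (x y a b : 'I_r) : biseries r := mono [:: (x, a); (y, b)].

(* Only used for b <= a, so that the else branch is the case a = b. *)
Definition bracket (x y a b : 'I_r) : biseries r :=
  if (b < a)%N then bi2 y x b a + bi2 y x a b - bi2 x y b a
  else bi2 y x a a.

Definition bracketq (x y a b : 'I_r) : biseries r :=
  if (b < a)%N then bi2 y x b a + q *: bi2 y x a b - q^-1 *: bi2 x y b a
  else q *: bi2 y x a a.

Definition relator E : Prop :=
  exists x y a b : 'I_r,
    [/\ (y < x)%N, (b <= a)%N & E = bi2 x y a b - bracket x y a b].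

Definition relatorq E : Prop :=
  exists x y a b : 'I_r,
    [/\ (y < x)%N, (b <= a)%N & E = bi2 x y a b - bracketq x y a b].

Definition idealI : {pred biseries r} := degreewise_ideal relator.
Definition idealIq : {pred biseries r} := degreewise_ideal relatorq.

Definition phi E : biseries r :=
  Biseries (fun alpha => coef E alpha * q ^ invm alpha).

Fact phi_is_linear : linear phi.
Proof.
by move=> c E F; apply: biseriesP => al /=; rewrite mulrDl mulrA.
Qed.
HB.instance Definition _ :=
  GRing.isLinear.Build laurent (biseries r) (biseries r) *:%R phi phi_is_linear.

Fact homog_is_linear n : linear (homog n).
Proof.
by move=> c E F; apply: biseriesP => al /=; case: ifP; rewrite ?mulr0 ?addr0.
Qed.
HB.instance Definition _ n := GRing.isLinear.Build laurent
  (biseries r) (biseries r) *:%R (homog n) (homog_is_linear n).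

Lemma homog_finite n E : finite_sum (homog n E).
Proof.
exists (map val (enum {: n.-tuple ('I_r * 'I_r)})) => al nal /=.
case: eqP => // sz; case/negP: nal; apply/mapP.
by exists (tcast sz (in_tuple al)); rewrite ?mem_enum //= val_tcast.
Qed.

Lemma homogM n E F :
  homog n (E * F) = \sum_(i < n.+1) homog i E * homog (n - i) F.
Proof.
apply: biseriesP => al; rewrite coef_sum [LHS]/=.
case: eqP => sz; last first.
  rewrite big1 // => i _; rewrite coefM /conv big1 // => j _ /=.
  case: eqP => [e1|_]; last by rewrite mul0r.
  case: eqP => [e2|_]; last by rewrite mulr0.
  case: sz; rewrite -(cat_take_drop j al) size_cat e1 e2 subnKC //.
  by rewrite -ltnS.
rewrite /conv sz.
rewrite [RHS](eq_bigr (fun i : 'I_n.+1 => \sum_(j < n.+1)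
   coef (homog i E) (take j al) * coef (homog (n - i) F) (drop j al))); last first.
  by move=> i _; rewrite [LHS]coefM /conv sz.
apply: eq_bigr => i _.
have szt : size (take i al) = i by rewrite size_takel // sz -ltnS.
rewrite (bigD1 i) //= !size_drop sz szt !eqxx big1 ?addr0 // => j ji.
rewrite /= size_takel; last by rewrite sz -ltnS.
by rewrite (_ : (j == i :> nat) = false) ?mul0r //; apply: negPf.
Qed.

Lemma finite0 : finite_sum 0. Proof. by exists [::]. Qed.

Lemma finiteN E : finite_sum E -> finite_sum (- E).
Proof. by case=> s sP; exists s => al /sP; rewrite coefN => ->; rewrite oppr0. Qed.

Lemma finiteZ c E : finite_sum E -> finite_sum (c *: E).
Proof. by case=> s sP; exists s => al /sP; rewrite coefZ => ->; rewrite mulr0. Qed.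

Lemma finite_mono al : finite_sum (mono al).
Proof. by exists [:: al] => be; rewrite inE /= => /negPf ->. Qed.

Lemma finiteM E F : finite_sum E -> finite_sum F -> finite_sum (E * F).
Proof.
case=> s sP [t tP]; exists [seq a ++ b | a <- s, b <- t] => al nal.
rewrite coefM /conv big1 // => i _.
have [ts|/sP->] := boolP (take i al \in s); last by rewrite mul0r.
have [dt|/tP->] := boolP (drop i al \in t); last by rewrite mulr0.
case/negP: nal; rewrite -(cat_take_drop i al).
exact: allpairs_f.
Qed.

Section Gens.
Variable gens : biseries r -> Prop.
Hypothesis gens0 : forall g, gens g -> coef g [::] = 0.

Lemma finite_ideal0 : finite_ideal gens 0.
Proof.
exists 0%N, (fun=> 0), (fun=> 0), (fun=> 0).
by split=> [[]|]; rewrite ?big_ord0.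
Qed.

Lemma finite_idealD E F :
  finite_ideal gens E -> finite_ideal gens F -> finite_ideal gens (E + F).
Proof.
case=> m [f [g [h [P ->]]]] [m' [f' [g' [h' [P' ->]]]]].
pose cat (u : 'I_m -> biseries r) (u' : 'I_m' -> biseries r) i :=
  match split i with inl j => u j | inr j => u' j end.
exists (m + m')%N, (cat f f'), (cat g g'), (cat h h').
split=> [i|]; first by rewrite /cat; case: (split i).
rewrite big_split_ord /cat; congr (_ + _); apply: eq_bigr => i _.
  by rewrite (unsplitK (inl i)).
by rewrite (unsplitK (inr i)).
Qed.

Lemma finite_ideal_sum I (s : seq I) (P : pred I) (E : I -> biseries r) :
  (forall i, P i -> finite_ideal gens (E i)) ->
  finite_ideal gens (\sum_(i <- s | P i) E i).
Proof.
by move=> H; elim/big_ind: _ => //; [exact: finite_ideal0|exact: finite_idealD].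
Qed.

Lemma finite_ideal_gen f g h : finite_sum f -> gens g -> finite_sum h ->
  finite_ideal gens (f * g * h).
Proof.
move=> Hf Hg Hh; exists 1%N, (fun=> f), (fun=> g), (fun=> h).
by split; rewrite ?big_ord1.
Qed.

Lemma finite_idealMl f E : finite_sum f ->
  finite_ideal gens E -> finite_ideal gens (f * E).
Proof.
move=> Hf [m [f' [g [h [P ->]]]]]; rewrite mulr_sumr.
apply: finite_ideal_sum => i _; rewrite !mulrA; have [? ? ?] := P i.
by apply: finite_ideal_gen => //; apply: finiteM.
Qed.

Lemma finite_idealMr f E : finite_sum f ->
  finite_ideal gens E -> finite_ideal gens (E * f).
Proof.
move=> Hf [m [f' [g [h [P ->]]]]]; rewrite mulr_suml.
apply: finite_ideal_sum => i _; rewrite -mulrA; have [? ? ?] := P i.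
by apply: finite_ideal_gen => //; apply: finiteM.
Qed.

Lemma finite_idealZ c E : finite_ideal gens E -> finite_ideal gens (c *: E).
Proof.
rewrite -[E in c *: E]mul1r scalerAl; apply: finite_idealMl.
by apply: finiteZ; apply: (finite_mono [::]).
Qed.

Lemma degreewise_zmod_closed : zmod_closed (degreewise_ideal gens).
Proof.
split=> [|E F /asboolP HE /asboolP HF]; apply/asboolP => n.
  by rewrite linear0; apply: finite_ideal0.
rewrite linearB -scaleN1r; apply: finite_idealD; first exact: HE.
by apply: finite_idealZ; apply: HF.
Qed.

Lemma degreewiseMl E F :
  F \in degreewise_ideal gens -> E * F \in degreewise_ideal gens.
Proof.
move=> /asboolP HF; apply/asboolP => n; rewrite homogM.
apply: finite_ideal_sum => i _; apply: finite_idealMl => //.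
exact: homog_finite.
Qed.

Lemma degreewiseMr E F :
  F \in degreewise_ideal gens -> F * E \in degreewise_ideal gens.
Proof.
move=> /asboolP HF; apply/asboolP => n; rewrite homogM.
apply: finite_ideal_sum => i _; apply: finite_idealMr => //.
exact: homog_finite.
Qed.

Lemma degreewise1 : 1 \notin degreewise_ideal gens.
Proof.
apply/negP => /asboolP/(_ 0%N) [m [f [g [h [P]]]]].
move=> /(congr1 (fun E => coef E [::])); rewrite coef_sum big1.
  by move/eqP => /=; rewrite oner_eq0.
move=> i _; rewrite !coefM !conv_nil coefM conv_nil.
by have [_ /gens0-> _] := P i; rewrite mulr0 mul0r.
Qed.

End Gens.

Lemma relator0 g : relator g -> coef g [::] = 0.
Proof.
case=> x [y [a [b [_ _ ->]]]]; rewrite /bracket; case: ifP => _;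
by rewrite !(coefD, coefN) /= ?(oppr0, addr0).
Qed.

Lemma relatorq0 g : relatorq g -> coef g [::] = 0.
Proof.
case=> x [y [a [b [_ _ ->]]]]; rewrite /bracketq; case: ifP => _;
by rewrite !(coefD, coefN, coefZ) /= ?(mulr0, oppr0, addr0).
Qed.

End Algebra.

Arguments idealI r : clear implicits.
Arguments idealIq r : clear implicits.

(* The library puts a ring structure on {quot I} only for commutative rings;
   quotA is the same quotient, with its algebra structure, for a two-sided
   ideal. Properness is required because algebras are nontrivial rings here. *)

HB.mixin Record isProperTwoSided (R : pzRingType) (A : algType R)
    (S : {pred A}) := {
  twosidedMl : forall u v : A, v \in S -> u * v \in S;
  twosidedMr : forall u v : A, v \in S -> v * u \in S;
  twosided1 : 1 \notin S
}.

#[short(type="idealType")]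
HB.structure Definition TwoSidedIdeal (R : pzRingType) (A : algType R) :=
  {S of GRing.ZmodClosed A S & isProperTwoSided R A S}.

Arguments idealType {R} A.

Section QuotientAlgebra.
Variables (R : pzRingType) (A : algType R) (I : idealType A).

Definition quotA := Quotient.quot I.
HB.instance Definition _ := GRing.Zmodule.on quotA.
HB.instance Definition _ := Quotient.on quotA.

Definition piA (u : A) : quotA := \pi u.

Lemma piA_eq u v : (piA u = piA v) <-> (u - v \in I).
Proof. by rewrite (Quotient.idealrBE I); split=> [/eqP|/eqP]. Qed.

Lemma piA_repr X : piA (repr X) = X.
Proof. exact: reprK. Qed.

Fact piAD u v : piA (u + v) = piA u + piA v.
Proof. by rewrite /piA [LHS](Quotient.pi_add I). Qed.

Definition oneA : quotA := piA 1.
Definition mulA (X Y : quotA) : quotA := piA (repr X * repr Y).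
Definition scaleA (c : R) (X : quotA) : quotA := piA (c *: repr X).

Lemma repr_piA u : repr (piA u) - u \in I.
Proof. by apply/piA_eq; rewrite piA_repr. Qed.

Lemma piAM u v : piA (u * v) = mulA (piA u) (piA v).
Proof.
apply/esym/piA_eq; set u' := repr _; set v' := repr _.
have -> : u' * v' - u * v = (u' - u) * v' + u * (v' - v).
  by rewrite mulrBl mulrBr addrA addrNK.
by apply: rpredD; [apply: twosidedMr|apply: twosidedMl]; apply: repr_piA.
Qed.

Lemma piAZ c u : piA (c *: u) = scaleA c (piA u).
Proof.
apply/esym/piA_eq; rewrite -scalerBr -[_ - _]mul1r scalerAl.
by rewrite twosidedMl ?repr_piA.
Qed.

Fact mulAA : associative mulA.
Proof.
move=> X Y Z; rewrite -[X]piA_repr -[Y]piA_repr -[Z]piA_repr.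
by rewrite -!piAM mulrA.
Qed.
Fact mul1A : left_id oneA mulA.
Proof. by move=> X; rewrite -[X]piA_repr -piAM mul1r. Qed.
Fact mulA1 : right_id oneA mulA.
Proof. by move=> X; rewrite -[X]piA_repr -piAM mulr1. Qed.
Fact mulADl : left_distributive mulA +%R.
Proof.
move=> X Y Z; rewrite -[X]piA_repr -[Y]piA_repr -[Z]piA_repr.
by rewrite -piAD -!piAM -piAD mulrDl.
Qed.
Fact mulADr : right_distributive mulA +%R.
Proof.
move=> X Y Z; rewrite -[X]piA_repr -[Y]piA_repr -[Z]piA_repr.
by rewrite -piAD -!piAM -piAD mulrDr.
Qed.
Fact oneA_neq0 : oneA != 0.
Proof.
have pi0 : piA 0 = 0 by apply: (addrI (piA 0)); rewrite -piAD !addr0.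
apply/eqP; rewrite -pi0 => /piA_eq; rewrite subr0.
exact/negP/twosided1.
Qed.

HB.instance Definition _ := GRing.Zmodule_isNzRing.Build quotA
  mulAA mul1A mulA1 mulADl mulADr oneA_neq0.

Fact scaleAA a b X : scaleA a (scaleA b X) = scaleA (a * b) X.
Proof. by rewrite -[X]piA_repr -!piAZ scalerA. Qed.
Fact scale1A : left_id 1 scaleA.
Proof. by move=> X; rewrite -[X]piA_repr -piAZ scale1r. Qed.
Fact scaleADr : right_distributive scaleA +%R.
Proof.
move=> a X Y; rewrite -[X]piA_repr -[Y]piA_repr.
by rewrite -piAD -!piAZ -piAD scalerDr.
Qed.
Fact scaleADl X : {morph scaleA^~ X : a b / a + b}.
Proof. by move=> a b; rewrite -[X]piA_repr -!piAZ -piAD scalerDl. Qed.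

HB.instance Definition _ := GRing.Zmodule_isLmodule.Build R quotA
  scaleAA scale1A scaleADr scaleADl.

Fact scaleAAl c X Y : c *: (X * Y : quotA) = (c *: X) * Y.
Proof.
rewrite -[X]piA_repr -[Y]piA_repr.
by rewrite /GRing.mul /GRing.scale /= -piAM -!piAZ -piAM scalerAl.
Qed.
Fact scaleAAr c X Y : c *: (X * Y : quotA) = X * (c *: Y).
Proof.
rewrite -[X]piA_repr -[Y]piA_repr.
by rewrite /GRing.mul /GRing.scale /= -piAM -!piAZ -piAM scalerAr.
Qed.

HB.instance Definition _ := GRing.Lmodule_isLalgebra.Build R quotA scaleAAl.
HB.instance Definition _ := GRing.Lalgebra_isAlgebra.Build R quotA scaleAAr.

Fact piA_is_linear : linear piA.
Proof. by move=> c u v; rewrite piAD piAZ. Qed.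
Fact piA_is_monoid_morphism : monoid_morphism piA.
Proof. by split=> // u v; rewrite piAM. Qed.
HB.instance Definition _ := GRing.isLinear.Build R A quotA *:%R piA
  piA_is_linear.
HB.instance Definition _ := GRing.isMonoidMorphism.Build A quotA piA
  piA_is_monoid_morphism.

End QuotientAlgebra.

Section Quotients.
Variable r : nat.

HB.instance Definition _ := GRing.isZmodClosed.Build (biseries r) (idealI r)
  (degreewise_zmod_closed (@relator r)).
HB.instance Definition _ := isProperTwoSided.Build laurent (biseries r)
  (idealI r) (@degreewiseMl r (@relator r)) (@degreewiseMr r (@relator r))
  (degreewise1 (@relator0 r)).

HB.instance Definition _ := GRing.isZmodClosed.Build (biseries r) (idealIq r)
  (degreewise_zmod_closed (@relatorq r)).
HB.instance Definition _ := isProperTwoSided.Build laurent (biseries r)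
  (idealIq r) (@degreewiseMl r (@relatorq r)) (@degreewiseMr r (@relatorq r))
  (degreewise1 (@relatorq0 r)).

Definition circ_image (J : idealType (biseries r)) : {pred quotA J} :=
  fun X => `[< exists2 E, E \in @circular r & X = piA J E >].
Arguments circ_image : clear implicits.

Fact circ_image_closed J : GRing.subsemialg_closed (circ_image J).
Proof.
split.
- by apply/asboolP; exists 1; rewrite ?rpred1 ?rmorph1.
- split; first by apply/asboolP; exists 0; rewrite ?rpred0 ?raddf0.
  move=> _ _ /asboolP[E cE ->] /asboolP[F cF ->]; apply/asboolP.
  by exists (E + F); rewrite ?rpredD ?raddfD.
- move=> c _ /asboolP[E cE ->]; apply/asboolP.
  by exists (c *: E); rewrite ?rpredZ ?linearZ.
- move=> _ _ /asboolP[E cE ->] /asboolP[F cF ->]; apply/asboolP.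
  by exists (E * F); rewrite ?rpredM ?rmorphM.
Qed.
HB.instance Definition _ J :=
  GRing.isSubalgClosed.Build _ _ (circ_image J) (circ_image_closed J).

Record circ_quot (J : idealType (biseries r)) := CircQuot {
  circ_quot_val :> quotA J;
  _ : circ_quot_val \in circ_image J
}.
HB.instance Definition _ J := [isSub for @circ_quot_val J].
HB.instance Definition _ J := [Choice of circ_quot J by <:].
HB.instance Definition _ J := [SubChoice_isSubAlgebra of circ_quot J by <:].

End Quotients.

Section PhiBar.
Variable r : nat.
Implicit Types (al be : biword r) (E F : biseries r).

Lemma inv_cons (x : 'I_r) (w : seq 'I_r) :
  inv (x :: w) = (count (fun y : 'I_r => (y < x)%N) w + inv w)%N.
Proof.
have invE (s : seq 'I_r) : inv s = (\sum_(i < size s) \sum_(j < size s)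
    ((i < j) && (tnth (in_tuple s) j < tnth (in_tuple s) i)))%N.
  rewrite /inv -sum1_card big_mkcond pair_bigA.
  by apply: eq_bigr => p _; rewrite inE; case: ifP.
rewrite !invE /= big_ord_recl; congr (_ + _)%N.
  rewrite big_ord_recl /= add0n -sum1_count (big_tnth _ _ w) [RHS]big_mkcond.
  by apply: eq_bigr => i _; rewrite !(tnth_nth x) /=; case: ifP.
apply: eq_bigr => i _; rewrite big_ord_recl /= add0n.
by apply: eq_bigr => j _; rewrite !(tnth_nth x).
Qed.

Lemma inv_swap (u v : seq 'I_r) (x y : 'I_r) : (y < x)%N ->
  inv (u ++ [:: x, y & v]) = (inv (u ++ [:: y, x & v])).+1.
Proof.
move=> yx; elim: u => [|z u IH] /=.
  rewrite !inv_cons /= yx ltnNge (ltnW yx) /= add0n add1n !addSn.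
  by rewrite addnCA.
by rewrite !inv_cons IH addnS !count_cat /= [((x < z) + _)%N]addnCA.
Qed.

Lemma invm_swap_top al be (x y a b : 'I_r) : (y < x)%N ->
  invm (al ++ [:: (x, a); (y, b)] ++ be) =
  invm (al ++ [:: (y, a); (x, b)] ++ be) - 1.
Proof.
move=> yx; rewrite /invm /top /bottom /unzip1 /unzip2 !map_cat /= (inv_swap _ _ yx).
have H (m n : nat) : m%:Z - n.+1%:Z = m%:Z - n%:Z - 1.
  by rewrite intS opprD addrA addrAC.
exact: H.
Qed.

Lemma invm_swap_bottom al be (x y a b : 'I_r) : (b < a)%N ->
  invm (al ++ [:: (x, a); (y, b)] ++ be) =
  invm (al ++ [:: (x, b); (y, a)] ++ be) + 1.
Proof.
move=> ba; rewrite /invm /top /bottom /unzip1 /unzip2 !map_cat /= (inv_swap _ _ ba).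
have H (m n : nat) : m.+1%:Z - n%:Z = m%:Z - n%:Z + 1.
  by rewrite intS -addrA addrC.
exact: H.
Qed.

Lemma phi_mono al : phi (mono al) = q ^ invm al *: mono al.
Proof.
apply: biseriesP => be; rewrite coefZ /= mulrC.
by case: eqP => [->//|_]; rewrite !mulr0.
Qed.

Lemma mono_bi2 al be x y a b :
  mono al * bi2 x y a b * mono be = mono (al ++ [:: (x, a); (y, b)] ++ be).
Proof. by rewrite /bi2 !monoM catA. Qed.

Lemma phi_relator al be g : relator g -> exists c g',
  relatorq g' /\ phi (mono al * g * mono be) = c *: (mono al * g' * mono be).
Proof.
case=> x [y [a [b [yx ba ->]]]].
exists (q ^ invm (al ++ [:: (x, a); (y, b)] ++ be)).
exists (bi2 x y a b - bracketq x y a b); split; first by exists x, y, a, b.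
have qD m n : q ^ (m + n) = q ^ m * q ^ n by rewrite exprzDr ?q_unit.
have eT (u v : 'I_r) : invm (al ++ [:: (y, u), (x, v) & be]) =
    invm (al ++ [:: (x, u), (y, v) & be]) + 1.
  by have /= -> := invm_swap_top al be u v yx; rewrite addrNK.
rewrite /bracket /bracketq; case: ltnP => [lt_ba|le_ab].
- have eB (u v : 'I_r) : invm (al ++ [:: (u, a), (v, b) & be]) =
      invm (al ++ [:: (u, b), (v, a) & be]) + 1.
    by have /= -> := invm_swap_bottom al be u v lt_ba.
  rewrite !(opprD, opprK, mulrDr, mulrDl, mulrN, mulNr).
  rewrite -!(scalerAr, scalerAl) !mono_bi2.
  rewrite !(linearD, linearN) /= !phi_mono !eT !eB !qD expr1z.
  rewrite !scalerA mulrK ?q_unit //.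
- have -> : b = a by apply/val_inj/eqP; rewrite eqn_leq ba.
  rewrite !(opprD, opprK, mulrDr, mulrDl, mulrN, mulNr).
  rewrite -!(scalerAr, scalerAl) !mono_bi2.
  by rewrite !(linearD, linearN) /= !phi_mono !eT !qD expr1z scalerA.
Qed.

Lemma finite_sumE E : finite_sum E ->
  exists s : seq (biword r), E = \sum_(al <- s) coef E al *: mono al.
Proof.
case=> s sP; exists (undup s); apply: biseriesP => be.
rewrite coef_sum; have [bs|nbs] := boolP (be \in s); last first.
  rewrite sP // big_seq big1 // => al; rewrite mem_undup => als.
  rewrite coefZ /= (_ : (be == al) = false) ?mulr0 //.
  by apply: contraNF nbs => /eqP ->.
rewrite (bigD1_seq be) ?mem_undup ?undup_uniq //= eqxx mulr1.
rewrite big1 ?addr0 // => al; rewrite eq_sym => /negPf /= ->.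
by rewrite mulr0.
Qed.

Lemma phi_finite_ideal E :
  finite_ideal (@relator r) E -> finite_ideal (@relatorq r) (phi E).
Proof.
case=> m [f [g [h [P ->]]]]; rewrite linear_sum.
apply: finite_ideal_sum => i _; have [/finite_sumE[s ->] gg] := P i.
move=> /finite_sumE[t ->]; rewrite !mulr_suml linear_sum.
apply: finite_ideal_sum => al _; rewrite mulr_sumr linear_sum.
apply: finite_ideal_sum => be _.
rewrite -!scalerAl -scalerAr !linearZ /=; do 2!apply: finite_idealZ.
have [c [g' [Hg' ->]]] := phi_relator al be gg.
by apply/finite_idealZ/finite_ideal_gen => //; apply: finite_mono.
Qed.

Lemma homog_phi n E : homog n (phi E) = phi (homog n E).
Proof.
by apply: biseriesP => al /=; case: ifP => // _; rewrite mul0r.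
Qed.

Lemma phi_idealI E : E \in idealI r -> phi E \in idealIq r.
Proof.
move=> /asboolP HE; apply/asboolP => n; rewrite homog_phi.
exact: phi_finite_ideal.
Qed.

(* Independent of the chosen representative by phibar_piA. *)
Definition phibar (X : quotA (idealI r)) : quotA (idealIq r) :=
  piA (idealIq r) (phi (repr X)).

Lemma phibar_piA E : phibar (piA (idealI r) E) = piA (idealIq r) (phi E).
Proof. by apply/piA_eq; rewrite -linearB; apply: phi_idealI; apply: repr_piA. Qed.

Fact phibar_is_linear : linear phibar.
Proof.
move=> c X Y; rewrite -[X]piA_repr -[Y]piA_repr -linearP !phibar_piA.
by rewrite !linearP.
Qed.
HB.instance Definition _ := GRing.isLinear.Build laurent
  (quotA (idealI r)) (quotA (idealIq r)) *:%R phibar phibar_is_linear.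

End PhiBar.

(* Main.v *)
From HB Require Import structures.
Require Import Defs.
From mathcomp Require Import all_boot all_order all_algebra.
From mathcomp Require Import boolp ring.
Import GRing.Theory.
Local Open Scope ring_scope.

(** The number of inversions of a concatenation [u ++ v] exceeds
    [inv u + inv v] by a quantity depending only on the letter contents of [u]
    and [v].  For two circuits the top and bottom contents agree, so these
    excesses cancel in [invm]: the weight is additive and [phi] is
    multiplicative on circular elements.  Dividing by the weight inverts [phi],
    preserves circularity and carries each q-relator, up to a unit, back to a
    relator; hence the induced map is bijective. *)

Section WeightTwist.
Variable r : nat.
Implicit Types (al be : biword r) (E F : biseries r).

(** The last sum counts the inversions straddling the cut; in this form it is visibly unchanged when
    [u] or [v] is permuted. *)
Lemma inv_cat (u v : seq 'I_r) :
  Defs.inv (u ++ v) =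
  (Defs.inv u + Defs.inv v + \sum_(x <- u) count (fun y : 'I_r => (y < x)%N) v)%N.
Proof.
elim: u => [|x u IH] /=.
  have -> : Defs.inv (Nil 'I_r) = 0%N by apply: eq_card0 => -[[]].
  by rewrite big_nil addn0.
by rewrite !inv_cons IH big_cons count_cat !addnA; ring.
Qed.

Lemma invm_cat al be :
  circuit al -> circuit be -> invm (al ++ be) = invm al + invm be.
Proof.
rewrite /circuit /invm /top /bottom /unzip1 /unzip2 => cal cbe.
(* The straddling sum of the top words is turned into that of the bottom words: [cal] changes its
   range, then [cbe] its counts. *)
rewrite !map_cat !inv_cat (perm_big _ cal) /=.
under [in X in _ - X]eq_bigr => x _ do rewrite (permP cbe).
by rewrite !PoszD; ring.
Qed.

Lemma phiM E F : E \in @circular r -> F \in @circular r ->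
  phi (E * F) = phi E * phi F.
Proof.
move=> /asboolP cE /asboolP cF; apply: biseriesP => al /=.
rewrite /conv mulr_suml; apply: eq_bigr => i _ /=.
(* A cut with a factor that is not a circuit contributes zero to both sides, so additivity of the
   weight is only needed between circuits. *)
have [c1|/cE->] := boolP (circuit (take i al)); last by rewrite !mul0r.
have [c2|/cF->] := boolP (circuit (drop i al)); last by rewrite !(mulr0, mul0r).
have -> : invm al = invm (take i al) + invm (drop i al).
  by rewrite -invm_cat ?cat_take_drop.
by rewrite exprzDr ?q_unit // mulrACA.
Qed.

Lemma phi1 : phi 1 = 1 :> biseries r.
Proof.
rewrite [LHS](phi_mono [::]) (_ : invm [::] = 0) ?scale1r //.
by rewrite /invm subrr.
Qed.

Lemma phi_circular E : E \in @circular r -> phi E \in @circular r.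
Proof.
by move=> /asboolP cE; apply/asboolP => al /cE /= ->; rewrite mul0r.
Qed.

Definition phi_inv E : biseries r :=
  Biseries (fun al => coef E al * q ^ (- invm al)).

Fact phi_inv_is_linear : linear phi_inv.
Proof. by move=> c E F; apply: biseriesP => al /=; rewrite mulrDl mulrA. Qed.
HB.instance Definition _ := GRing.isLinear.Build laurent
  (biseries r) (biseries r) *:%R phi_inv phi_inv_is_linear.

Lemma phiK : cancel (@phi r) phi_inv.
Proof.
move=> E; apply: biseriesP => al /=.
by rewrite -mulrA -exprzDr ?q_unit // subrr mulr1.
Qed.

Lemma phi_invK : cancel phi_inv (@phi r).
Proof.
move=> E; apply: biseriesP => al /=.
by rewrite -mulrA -exprzDr ?q_unit // addNr mulr1.
Qed.

Lemma phi_inv_circular E : E \in @circular r -> phi_inv E \in @circular r.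
Proof.
by move=> /asboolP cE; apply/asboolP => al /cE /= ->; rewrite mul0r.
Qed.

Lemma phi_inv_mono al : phi_inv (mono al) = q ^ (- invm al) *: mono al.
Proof.
apply: (can_inj phiK); rewrite phi_invK linearZ /= phi_mono scalerA.
by rewrite -exprzDr ?q_unit // addNr scale1r.
Qed.

(** Each biword of the relator has weight 0, 1 or -1 relative to the leading one, and its
    coefficient carries exactly that power of [q]; dividing by the weights leaves one common factor
    [c]. *)
Lemma phi_inv_relatorq al be g : relatorq g -> exists c g', relator g' /\
  phi_inv (mono al * g * mono be) = c *: (mono al * g' * mono be).
Proof.
case=> x [y [a [b [yx ba ->]]]].
(* Keeping [c] opaque prevents [opprD] from unfolding [invm] inside it. *)
have [c cE] : exists c, c = q ^ (- invm (al ++ [:: (x, a), (y, b) & be])).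
  by eexists.
exists c; exists (bi2 x y a b - bracket x y a b); split; first by exists x, y, a, b.
have qVD m : q ^ (- (m + 1)) = q ^ (- m) * q^-1.
  by rewrite opprD exprzDr ?q_unit // exprN1.
have eT (u v : 'I_r) : invm (al ++ [:: (y, u), (x, v) & be]) =
    invm (al ++ [:: (x, u), (y, v) & be]) + 1.
  by have /= -> := invm_swap_top al be u v yx; rewrite addrNK.
rewrite /bracket /bracketq; case: ltnP => [lt_ba|le_ab].
- have eB (u v : 'I_r) : invm (al ++ [:: (u, a), (v, b) & be]) =
      invm (al ++ [:: (u, b), (v, a) & be]) + 1.
    by have /= -> := invm_swap_bottom al be u v lt_ba.
  rewrite !(opprD, opprK, mulrDr, mulrDl, mulrN, mulNr).
  rewrite -!(scalerAr, scalerAl) !mono_bi2.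
  (* All weights are referred to the smallest of the four, that of the biword with top pair [x y]
     and bottom pair [b a]. *)
  rewrite !(linearD, linearN, linearZ) /= !phi_inv_mono cE !eT !eB !qVD.
  rewrite !scalerN !scalerA !(mulrC q) !mulrVK ?q_unit //.
  by rewrite [q^-1 * _]mulrC.
- have ab : b = a by apply/val_inj/eqP; rewrite eqn_leq ba.
  rewrite ab in cE *.
  rewrite !(opprD, opprK, mulrDr, mulrDl, mulrN, mulNr).
  rewrite -!(scalerAr, scalerAl) !mono_bi2.
  rewrite !(linearD, linearN, linearZ) /= !phi_inv_mono cE !eT !qVD.
  by rewrite !scalerN scalerA (mulrC q) mulrVK ?q_unit.
Qed.

(** Finite cofactors are linear combinations of biwords, so by linearity only a relator between two
    biwords has to be treated. *)
Lemma phi_inv_finite_ideal E :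
  finite_ideal (@relatorq r) E -> finite_ideal (@relator r) (phi_inv E).
Proof.
case=> m [f [g [h [P ->]]]]; rewrite linear_sum.
apply: finite_ideal_sum => i _; have [/finite_sumE[s ->] gg] := P i.
move=> /finite_sumE[t ->]; rewrite !mulr_suml linear_sum.
apply: finite_ideal_sum => al _; rewrite mulr_sumr linear_sum.
apply: finite_ideal_sum => be _.
rewrite -!scalerAl -scalerAr !linearZ /=; do 2!apply: finite_idealZ.
have [c [g' [Hg' ->]]] := phi_inv_relatorq al be _ gg.
by apply/finite_idealZ/finite_ideal_gen => //; apply: finite_mono.
Qed.

Lemma phi_inv_idealIq E : E \in idealIq r -> phi_inv E \in idealI r.
Proof.
move=> /asboolP HE; apply/asboolP => n.
(* Conjugating [homog_phi] shows that [phi_inv] commutes with [homog n] too. *)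
rewrite -[homog n _]phiK -homog_phi phi_invK.
exact: phi_inv_finite_ideal.
Qed.

Definition phibar_inv (Y : quotA (idealIq r)) : quotA (idealI r) :=
  piA (idealI r) (phi_inv (repr Y)).

(** Independence of the representative: two of them differ by an element of [idealIq r], which
    [phi_inv] sends into [idealI r]. *)
Lemma phibar_inv_piA E :
  phibar_inv (piA (idealIq r) E) = piA (idealI r) (phi_inv E).
Proof.
by apply/piA_eq; rewrite -linearB; apply: phi_inv_idealIq; apply: repr_piA.
Qed.

Lemma phibarK : cancel (@phibar r) phibar_inv.
Proof. by move=> X; rewrite -[X]piA_repr phibar_piA phibar_inv_piA phiK. Qed.

Lemma phibar_invK : cancel phibar_inv (@phibar r).
Proof. by move=> X; rewrite -[X]piA_repr phibar_inv_piA phibar_piA phi_invK. Qed.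

Lemma phibar_circ_image X :
  X \in @circ_image r (idealI r) -> phibar X \in @circ_image r (idealIq r).
Proof.
move=> /asboolP[E cE ->]; apply/asboolP; exists (phi E).
  exact: phi_circular.
exact: phibar_piA.
Qed.

(** This makes the restriction onto: bijectivity on the full quotients alone does not place the
    preimage of a circular class among the circular classes. *)
Lemma phibar_inv_circ_image Y :
  Y \in @circ_image r (idealIq r) -> phibar_inv Y \in @circ_image r (idealI r).
Proof.
move=> /asboolP[E cE ->]; apply/asboolP; exists (phi_inv E).
  exact: phi_inv_circular.
exact: phibar_inv_piA.
Qed.

Lemma phibarM : {in @circ_image r (idealI r) &, {morph @phibar r : X Y / X * Y}}.
Proof.
(* The representatives picked by [repr] need not be circular, so circular ones are chosen before
   [phiM] is applied. *)
move=> _ _ /asboolP[E cE ->] /asboolP[F cF ->].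
by rewrite -rmorphM !phibar_piA phiM // rmorphM.
Qed.

Lemma phibar1 : @phibar r 1 = 1.
Proof. by rewrite -(rmorph1 (piA (idealI r))) phibar_piA phi1 rmorph1. Qed.

Definition circ_phibar (X : circ_quot (idealI r)) : circ_quot (idealIq r) :=
  CircQuot (phibar_circ_image _ (valP X)).

Definition circ_phibar_inv (Y : circ_quot (idealIq r)) : circ_quot (idealI r) :=
  CircQuot (phibar_inv_circ_image _ (valP Y)).

Lemma circ_phibar_bij : bijective circ_phibar.
Proof.
exists circ_phibar_inv => X; apply: val_inj; first exact: phibarK.
exact: phibar_invK.
Qed.

Fact circ_phibar_is_linear : linear circ_phibar.
Proof.
by move=> c X Y; apply: val_inj; rewrite linearP /= linearP.
Qed.

Fact circ_phibar_is_monoid_morphism : monoid_morphism circ_phibar.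
Proof.
split=> [|X Y]; apply: val_inj; first by rewrite !rmorph1 /= phibar1.
by rewrite rmorphM /= phibarM //; apply: valP.
Qed.

HB.instance Definition _ := GRing.isLinear.Build laurent
  (circ_quot (idealI r)) (circ_quot (idealIq r)) *:%R circ_phibar
  circ_phibar_is_linear.
HB.instance Definition _ := GRing.isMonoidMorphism.Build
  (circ_quot (idealI r)) (circ_quot (idealIq r)) circ_phibar
  circ_phibar_is_monoid_morphism.

End WeightTwist.

Theorem theorem3 (r : nat) (hr : (2 <= r)%N) :
  exists f : {lrmorphism circ_quot (idealI r) -> circ_quot (idealIq r)},
    bijective f /\
    forall X : circ_quot (idealI r), circ_quot_val (f X) = phibar (circ_quot_val X).
Proof. by exists (@circ_phibar r); split=> //; apply: circ_phibar_bij. Qed.
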